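(* Let $q$ be a prime power and $n\ge2$ an integer. Then $$p(\mathrm{GL}_n(\mathbb{F}_q))\le \frac{q^n-1}{q-1}\cdot(q-1)_{n,q}+T_{n,q}(q-1).$$
   Context: For a finite group $G$, $p(G)$ is the smallest natural number $m$ such that the symmetric group $S_m$ has a subgroup isomorphic to $G$. Write $q-1=p_1^{a_1}\cdots p_s^{a_s}q_1^{b_1}\cdots q_t^{b_t}$ (prime factorization into distinct primes, positive exponents), where $p_1,\dots,p_s$ are exactly the primes dividing $\gcd(n,q-1)$. Then $(q-1)_{n,q}=p_1^{a_1}\cdots p_s^{a_s}$ and $T_{n,q}(q-1)=\sum_{i=1}^t q_i^{b_i}$ (an empty product is $1$ and an empty sum is $0$). *)

(* Defs.v *)
From HB Require Import structures.
From mathcomp Require Import all_boot all_fingroup all_algebra.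

Set Implicit Arguments.
Unset Strict Implicit.
Unset Printing Implicit Defensive.

Import GroupScope.

Definition embeds_in_Sym (gT : finGroupType) (G : {group gT}) (m : nat) : bool :=
  [exists H : {group 'S_m}, G \isog H].

Section Cayley.

Variable gT : finGroupType.

Definition cayley_fun (x : gT) (i : 'I_#|gT|) : 'I_#|gT| :=
  enum_rank (enum_val i * x).

Lemma cayley_fun_inj x : injective (cayley_fun x).
Proof. by move=> i j /enum_rank_inj/mulIg/enum_val_inj. Qed.

Definition cayley (x : gT) : 'S_#|gT| := perm (@cayley_fun_inj x).

Lemma cayleyM : {in [set: gT] &, {morph cayley : x y / x * y}}.
Proof.
move=> x y _ _; apply/permP=> i.
by rewrite permM !permE /cayley_fun enum_rankK mulgA.
Qed.

Canonical cayley_morphism := Morphism cayleyM.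

Lemma cayley_inj : 'injm cayley.
Proof.
apply/injmP=> x y _ _ /permP/(_ (enum_rank 1)).
by rewrite !permE /cayley_fun enum_rankK !mul1g => /enum_rank_inj.
Qed.

End Cayley.

Lemma embeds_in_some_Sym (gT : finGroupType) (G : {group gT}) :
  exists m, embeds_in_Sym G m.
Proof.
exists #|gT|; apply/existsP; exists (cayley_morphism gT @* G)%G.
by apply: sub_isog; rewrite ?subsetT ?cayley_inj.
Qed.

Definition min_perm_degree (gT : finGroupType) (G : {group gT}) : nat :=
  ex_minn (embeds_in_some_Sym G).

Local Open Scope nat_scope.

(* For a prime p dividing m, [p ^ logn p m] is the full power of p occurring  *)
(* in the prime factorization of m. The notations (m)_{n,q} and T_{n,q}(m)    *)
(* are used at m = q - 1, split along the primes dividing gcd(n, q - 1).      *)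
Definition gcd_part (n q m : nat) : nat :=
  \prod_(p <- primes m | p %| gcdn n (q - 1)) p ^ logn p m.

Definition T_sum (n q m : nat) : nat :=
  \sum_(p <- primes m | ~~ (p %| gcdn n (q - 1))) p ^ logn p m.

(* Main.v *)
(** GL_n(F) acts on the K-classes of nonzero vectors, where K is the largest
    subgroup of F^* of order prime to gcd(n, q-1), and for each prime p dividing q-1 but
    not n it acts by translation on the p-part of F^* through the p-part of the
    determinant. An element acting trivially on the classes is a scalar a in K;
    its determinant a^n has trivial p-part for all these p, and then so does a
    since p does not divide n. Hence a = 1, and the disjoint union of these
    sets is a faithful permutation representation. *)
Require Import Defs.
From mathcomp Require Import all_boot all_fingroup all_algebra all_solvable.

Set Implicit Arguments.
Unset Strict Implicit.
Unset Printing Implicit Defensive.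

Local Open Scope group_scope.

(** Kernel and degree are only bounded above, so that representations can be combined without
    computing either exactly. For [N = 1] the representation is faithful. *)
Definition perm_rep (gT : finGroupType) (G : {group gT}) (N : {set gT}) m :=
  exists (T : finType) (f : {morphism G >-> {perm T}}),
    #|T| <= m /\ 'ker f \subset N.

(** * Permutations of disjoint unions, and relabelling by ordinals *)

Section SumPerm.

Variables T1 T2 : finType.
Implicit Types (s : {perm T1}) (t : {perm T2}).

Definition sum_perm_fun s t (x : T1 + T2) : T1 + T2 :=
  match x with inl a => inl (s a) | inr b => inr (t b) end.

Lemma sum_perm_inj s t : injective (sum_perm_fun s t).
Proof. by move=> [a|b] [c|d] //= [] /perm_inj->. Qed.

Definition sum_perm s t := perm (@sum_perm_inj s t).

Lemma sum_permM s1 t1 s2 t2 :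
  sum_perm (s1 * s2) (t1 * t2) = sum_perm s1 t1 * sum_perm s2 t2.
Proof. by apply/permP=> -[a|b]; rewrite permM !permE /= permM. Qed.

Lemma sum_perm_eq1 s t : sum_perm s t = 1 -> s = 1 /\ t = 1.
Proof.
move=> /permP st1; split; apply/permP=> x.
  by have:= st1 (inl x); rewrite !permE /= => -[].
by have:= st1 (inr x); rewrite !permE /= => -[].
Qed.

End SumPerm.

Section EnumPerm.

Variable T : finType.
Implicit Type s : {perm T}.

Lemma enum_perm_inj s : injective (fun i : 'I_#|T| => enum_rank (s (enum_val i))).
Proof. by move=> i j /enum_rank_inj/perm_inj/enum_val_inj. Qed.

Definition enum_perm s : 'S_#|T| := perm (@enum_perm_inj s).

Lemma enum_permM : {in [set: {perm T}] &, {morph enum_perm : s t / s * t}}.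
Proof.
by move=> s t _ _; apply/permP=> i; rewrite permM !permE enum_rankK.
Qed.

Canonical enum_perm_morphism := Morphism enum_permM.

Lemma injm_enum_perm : 'injm enum_perm.
Proof.
apply/injmP=> s t _ _ /permP st; apply/permP=> x.
by have:= st (enum_rank x); rewrite !permE enum_rankK => /enum_rank_inj.
Qed.

End EnumPerm.

(** * Permutation representations with controlled kernel and degree *)

Section PermRep.

Variables (gT : finGroupType) (G : {group gT}).
Implicit Type N : {set gT}.

Lemma perm_repS N1 N2 m1 m2 :
  N1 \subset N2 -> m1 <= m2 -> perm_rep G N1 m1 -> perm_rep G N2 m2.
Proof.
move=> sN12 le12 [T [f [leT kf]]]; exists T, f; split.
  exact: leq_trans le12.
exact: subset_trans sN12.
Qed.

(** On the disjoint union of two [G]-sets an element acts trivially only if it does so on both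
    pieces, while the degrees add. *)
Lemma perm_repI N1 N2 m1 m2 :
  perm_rep G N1 m1 -> perm_rep G N2 m2 -> perm_rep G (N1 :&: N2) (m1 + m2).
Proof.
move=> [T1 [f1 [le1 k1]]] [T2 [f2 [le2 k2]]].
pose h x := sum_perm (f1 x) (f2 x).
have hM : {in G &, {morph h : x y / x * y}}.
  by move=> x y Gx Gy; rewrite /h !morphM // sum_permM.
exists (T1 + T2)%type, (Morphism hM); split; first by rewrite card_sum leq_add.
apply/subsetP=> x /morphpreP[Gx /set1P /sum_perm_eq1[fx1 fx2]].
by rewrite inE (subsetP k1) ?(subsetP k2) //; apply/kerP.
Qed.

Lemma perm_repT : perm_rep G G 0.
Proof.
exists void, (@trivm _ _ G); split; first by rewrite card_void.
exact: subsetIl.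
Qed.

Lemma perm_rep_big (I : Type) (r : seq I) (P : pred I) (N : I -> {set gT}) m :
    (forall i, P i -> perm_rep G (N i) (m i)) ->
  perm_rep G (G :&: \bigcap_(i <- r | P i) N i) (\sum_(i <- r | P i) m i).
Proof.
move=> repN; elim: r => [|i r IHr].
  by rewrite !big_nil setIT; apply: perm_repT.
rewrite !big_cons; case: ifP => // Pi.
by rewrite setICA; apply: perm_repI => //; apply: repN.
Qed.

Lemma perm_rep_acts (aD : {group gT}) (T : finType) (to : action aD T)
    (S : {set T}) :
  [acts G, on S | to] -> perm_rep G 'C(S | to) #|S|.
Proof.
move=> actsGS; pose toS := to^?%act : action _ {x | x \in S}.
have sGD : G \subset subact_dom [in S] to.
  have set_id : [set x | x \in S] = S by apply/setP=> x; rewrite inE.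
  apply/subsetP=> a Ga; have := subsetP actsGS a Ga.
  by rewrite /subact_dom set_id.
exists {x | x \in S}, [morphism of restrm sGD (actperm toS)].
split; first by rewrite card_sig.
apply/subsetP=> a /morphpreP[Ga /set1P a1].
have Da := subsetP (acts_dom actsGS) a Ga.
rewrite !inE Da /=; apply/subsetP=> x Sx; rewrite inE.
have /(congr1 val) := congr1 (fun s : {perm _} => s (exist _ x Sx)) a1.
rewrite /= /restrm /= actpermE val_subact perm1 /= (subsetP sGD) // => ->.
by [].
Qed.

(** [G] acts on the image of [f] by right translation through [f]. An element acting trivially fixes
    the point [1], so its image under [f] is [1]. *)
Lemma perm_rep_morphism (rT : finGroupType) (f : {morphism G >-> rT}) :
  perm_rep G ('ker f) #|f @* G|.
Proof.
have actsR : [acts G, on f @* G | 'R \o f].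
  apply/subsetP=> a Ga; rewrite !inE Ga /=.
  by apply/subsetP=> x fGx; rewrite inE /= groupM // mem_morphim.
have [T [g [leT kg]]] := perm_rep_acts actsR; exists T, g; split=> //.
apply: subset_trans kg _; rewrite astab_comp; apply: morphpreS.
apply/subsetP=> y /astabP/(_ 1 (group1 (f @* G))) /=.
by rewrite mul1g => ->; apply: set11.
Qed.

Lemma min_perm_degree_le m : perm_rep G 1 m -> min_perm_degree G <= m.
Proof.
move=> [T [f [leT kf]]]; rewrite /min_perm_degree.
case: ex_minnP => k _ /(_ #|T|) min_k; apply: leq_trans leT; apply: min_k.
apply/existsP; exists (enum_perm_morphism T @* (f @* G))%G.
apply: isog_trans (sub_isog (subxx G) kf) _.
by apply: sub_isog; rewrite ?subsetT ?injm_enum_perm.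
Qed.

End PermRep.

(** The factors of the defining product at numbers outside [primes m] are [1], since [logn] vanishes
    there. *)
Lemma partn_primes (pi : nat_pred) m :
  (m`_pi = \prod_(p <- primes m | p \in pi) p ^ logn p m)%N.
Proof.
rewrite /partn (bigID [in primes m]) /= [X in (_ * X)%N]big1 ?muln1; last first.
  by move=> p /andP[_]; rewrite -logn_gt0 -eqn0Ngt => /eqP->.
under eq_bigl do rewrite andbC.
by rewrite -big_filter_cond filter_pi_of.
Qed.

(** * Matrices and scalars acting on row vectors *)

Section GL.

Variables (F : finFieldType) (n : nat).

(** The size [n.-1.+1] is the one built into ['GL_n[F]]; it equals [n] once [n > 0]. *)
Local Notation V := 'rV[F]_n.-1.+1.
Local Notation U := {unit F}.
Implicit Types (A : {'GL_n[F]}) (a : U) (v : V) (pi : nat_pred) (p : nat).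

Definition GL_mulrv v A : V := v *m GLval A.

Lemma GL_mulrv_is_action : is_action [set: {'GL_n[F]}] GL_mulrv.
Proof.
apply: is_total_action => [v | v A B]; first by rewrite /GL_mulrv mulmx1.
by rewrite /GL_mulrv GL_MxE mulmxA.
Qed.

Canonical GL_mulrv_action := Action GL_mulrv_is_action.

Definition unit_scale v a : V := (val a *: v)%R.

Lemma unit_scale_is_action : is_action [set: U] unit_scale.
Proof.
apply: is_total_action => [v | v a b]; first by rewrite /unit_scale GRing.scale1r.
by rewrite /unit_scale GRing.scalerA GRing.mulrC.
Qed.

Canonical unit_scale_action := Action unit_scale_is_action.

Lemma unit_scale_free v a : v != 0%R -> unit_scale v a = v -> a = 1.
Proof.
move=> v_n0 /(congr1 (fun w => w - v)%R).
rewrite GRing.subrr -{2}[v]GRing.scale1r -GRing.scalerBl => /eqP.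
rewrite GRing.scaler_eq0 (negPf v_n0) orbF GRing.subr_eq0 => /eqP a1.
exact: val_inj.
Qed.

Lemma GL_mulrvZ v a A :
  GL_mulrv (unit_scale v a) A = unit_scale (GL_mulrv v A) a.
Proof. by rewrite /GL_mulrv /unit_scale scalemxAl. Qed.

Lemma GL_mulrv_eq0 v A : (GL_mulrv v A == 0%R) = (v == 0%R).
Proof.
apply/eqP/eqP=> [|->]; last exact: mul0mx.
rewrite /GL_mulrv => /(congr1 (mulmxr (invmx (GLval A)))).
by rewrite /= mulmxK ?mul0mx // GL_unitmx.
Qed.

(** * Nonzero vectors modulo a group of scalars *)

Section ScaleOrbits.

Variable K : {group U}.

Definition scale_orbits : {set {set V}} :=
  orbit unit_scale_action K @: [set v | v != 0%R].

(** [K] acts freely on the nonzero vectors, so they are partitioned into orbits of size [#|K|]. *)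
Lemma card_scale_orbits :
  (#|scale_orbits| * #|K|)%N = (#|F| ^ n.-1.+1 - 1)%N.
Proof.
have actsK : [acts K, on [set v : V | v != 0%R] | unit_scale_action].
  apply/subsetP=> a Ka; rewrite !inE; apply/subsetP=> v; rewrite !inE.
  apply: contra => /eqP /= ua0; apply/eqP; move: ua0.
  rewrite /unit_scale => /eqP; rewrite GRing.scaler_eq0 => /orP[|/eqP//].
  by have := valP a; rewrite GRing.unitfE => /negPf->.
have /card_uniform_partition <- // := orbit_partition actsK.
  have -> : [set v : V | v != 0%R] = [set~ 0%R].
    by apply/setP=> v; rewrite !inE.
  by rewrite cardsC1 card_mx mul1n subn1.
move=> _ /imsetP[v + ->]; rewrite inE card_orbit => v_n0.
have -> : 'C_K[v | unit_scale_action] = 1%G.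
  apply/trivgP/subsetP=> a /setIP[_ /astab1P /= va].
  by rewrite inE (unit_scale_free v_n0 va).
by rewrite indexg1.
Qed.

Lemma GL_orbit v A :
  GL_mulrv_action^*%act (orbit unit_scale_action K v) A
    = orbit unit_scale_action K (GL_mulrv v A).
Proof.
rewrite /orbit /= /setact -imset_comp; apply: eq_imset => a /=.
exact: GL_mulrvZ.
Qed.

Lemma GL_acts_scale_orbits :
  [acts 'GL_n[F], on scale_orbits | GL_mulrv_action^*].
Proof.
apply/subsetP=> A _; rewrite !inE; apply/subsetP=> _ /imsetP[v v_n0 ->].
rewrite inE GL_orbit; apply: imset_f.
by move: v_n0; rewrite !inE GL_mulrv_eq0.
Qed.

(** Such an [A] has every nonzero vector as an eigenvector with eigenvalue in [K]. The standard
    basis vectors make [A] diagonal, and the all-ones vector makes the diagonal constant. *)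
Lemma astab_scale_orbits A :
    A \in 'C(scale_orbits | GL_mulrv_action^*) ->
  exists2 a, a \in K & GLval A = ((val a)%:M)%R.
Proof.
move=> cA.
have eigA v : v != 0%R -> exists2 a, a \in K & (v *m GLval A = val a *: v)%R.
  move=> v_n0; have vO : orbit unit_scale_action K v \in scale_orbits.
    by apply: imset_f; rewrite inE.
  have := astab_act cA vO; rewrite GL_orbit => /setP/(_ (GL_mulrv v A)).
  by rewrite orbit_refl => /esym/imsetP[a Ka eq_a]; exists a.
have [|a Ka eq1] := eigA (const_mx 1%R).
  apply/eqP=> /matrixP/(_ 0%R 0%R)/eqP; rewrite !mxE.
  by rewrite GRing.oner_eq0.
exists a => //.
have offdiag i j : j != i -> GLval A i j = 0%R.
  move=> ne_ji; have [|b _] := eigA (delta_mx 0%R i).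
    apply/eqP=> /matrixP/(_ 0%R i)/eqP; rewrite !mxE !eqxx.
    by rewrite GRing.oner_eq0.
  rewrite -rowE => /matrixP/(_ 0%R j); rewrite !mxE (negPf ne_ji) andbF.
  by rewrite GRing.mulr0.
apply/matrixP=> i j; rewrite mxE; case: eqP => [->|/eqP ne_ij]; last first.
  by rewrite offdiag // eq_sym.
(* Entry [j] of the all-ones vector times [A] is the sum of column [j], which reduces to the
   diagonal entry. *)
move/matrixP/(_ 0%R j): eq1; rewrite !mxE (bigD1 j) //= big1 => [|l ne_lj].
  by rewrite !mxE GRing.mul1r GRing.mulr1 GRing.addr0.
by rewrite offdiag ?GRing.mulr0 // eq_sym.
Qed.

End ScaleOrbits.

(** * Primary parts of the determinant *)

Definition GL_detU A : U :=
  FinRing.unit F (etrans (esym (unitmxE (GLval A))) (GL_unitmx A)).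

Lemma GL_detU_constM pi :
  {in 'GL_n[F] &, {morph (fun A => (GL_detU A).`_pi) : A B / A * B}}.
Proof.
move=> A B _ _ /=.
have -> : GL_detU (A * B) = GL_detU A * GL_detU B.
  by apply: val_inj; rewrite /= -det_mulmx.
by apply: consttM; apply: val_inj; apply: GRing.mulrC.
Qed.

Canonical GL_detU_constt pi := Morphism (@GL_detU_constM pi).

Lemma unit_abelian : abelian [set: U].
Proof. by apply/centsP=> a _ b _; apply: val_inj; apply: GRing.mulrC. Qed.

(** The image consists of [p]-elements of an abelian group, so it lies in the Sylow [p]-subgroup. *)
Lemma card_GL_detU_constt p :
  (#|GL_detU_constt p @* 'GL_n[F]| <= p ^ logn p #|[set: U]|)%N.
Proof.
have hallU := nilpotent_pcore_Hall p (abelian_nil unit_abelian).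
rewrite -p_part -(card_Hall hallU).
apply/subset_leq_card/subsetP=> _ /morphimP[A _ _ ->].
by rewrite (mem_Hall_pcore hallU) ?inE // p_elt_constt.
Qed.

(** The order of the [p]-part of [a] is a power of [p] dividing [n], hence [1]. *)
Lemma unit_constt_pow_eq1 a p : prime p -> ~~ (p %| n) ->
  (a ^+ n).`_p = 1 -> a.`_p = 1.
Proof.
move=> p_pr p'n; rewrite consttX => /eqP; rewrite -order_dvdn => dv_n.
apply/eqP; rewrite -order_eq1; apply/eqP.
have /p_natP[[|k] // def_o] : p.-nat #[a.`_p] := p_elt_constt p a.
by case/negP: p'n; apply: dvdn_trans dv_n; rewrite def_o expnS dvdn_mulr.
Qed.

(** If [a] were not [1], a prime [p] dividing its order would give a nontrivial [p]-part. *)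
Lemma unit_constt_eq1 a :
  {in primes #|[set: U]|, forall p, a.`_p = 1} -> a = 1.
Proof.
move=> a_p1; apply: contraTeq isT => a_neq1.
have [p p_pr p_o] : exists2 p, prime p & (p %| #[a])%N.
  by exists (pdiv #[a]); rewrite ?pdiv_dvd // pdiv_prime // order_gt1.
have /a_p1/eqP : p \in primes #|[set: U]|.
  by rewrite mem_primes p_pr cardG_gt0 (dvdn_trans p_o) // order_dvdG ?inE.
rewrite -order_eq1 order_constt partn_eq1 ?order_gt0 // => /pnatP.
by move=> /(_ (order_gt0 a) p p_pr p_o); rewrite !inE eqxx.
Qed.

Lemma GL_degree_le pi : n > 0 ->
    {in primes (#|F| - 1), forall p, p \notin pi -> ~~ (p %| n)} ->
  (min_perm_degree 'GL_n[F] <=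
    (#|F| ^ n - 1) %/ (#|F| - 1) * (#|F| - 1)`_pi
      + \sum_(p <- primes (#|F| - 1) | p \notin pi) p ^ logn p (#|F| - 1))%N.
Proof.
move=> n_gt0.
have -> : (#|F| - 1)%N = #|[set: U]| by rewrite card_finField_unit subn1.
set m := #|[set: U]| => pi'n; have m_gt0 : (0 < m)%N by apply: cardG_gt0.
(* The scalars divided out form the Hall [pi^']-subgroup, whose index in [U] is the [pi]-part of
   [m]. *)
pose K := 'O_pi^'([set: U])%G.
have hallK : pi^'.-Hall([set: U]) K.
  exact: nilpotent_pcore_Hall (abelian_nil unit_abelian).
apply: min_perm_degree_le.
have repV := perm_rep_acts (GL_acts_scale_orbits K).
have repdet p : p \notin pi ->
    perm_rep 'GL_n[F] ('ker (GL_detU_constt p)) (p ^ logn p m)%N.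
  move=> _; apply: perm_repS (perm_rep_morphism _) => //.
  exact: card_GL_detU_constt.
apply: perm_repS (perm_repI repV (perm_rep_big (primes m) repdet)).
  apply/subsetP=> A /setIP[/astab_scale_orbits[a Ka defA] /setIP[_ kA]].
  have det_a : GL_detU A = a ^+ n.
    apply: val_inj; rewrite /= defA det_scalar FinRing.val_unitX.
    by rewrite prednK.
  suffices a1 : a = 1 by rewrite inE; apply/eqP/val_inj; rewrite /= defA a1.
  (* For [p] in [pi] the [p]-part of [a] vanishes because [a] lies in [K]; for the other [p] the
     determinant [a ^+ n] detects it. *)
  apply: unit_constt_eq1 => p m_p; have [pi_p | pi'p] := boolP (p \in pi).
    rewrite (mem_Hall_pcore hallK) ?inE // in Ka.
    apply/constt1P; apply: sub_in_pnat Ka => r _.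
    by apply: contraL => /eqnP->; rewrite inE negbK.
  have p_pr : prime p by move: m_p; rewrite mem_primes => /andP[].
  apply: (unit_constt_pow_eq1 p_pr (pi'n p m_p pi'p)); rewrite -det_a.
  suffices : A \in 'ker (GL_detU_constt p) by apply: mker.
  by move: kA; rewrite (big_rem p m_p) /= pi'p => /setIP[].
(* After multiplication by [#|K|] both sides become [#|F| ^ n - 1], provided [#|F| - 1] divides that
   number. *)
rewrite leq_add2r -(leq_pmul2r (cardG_gt0 K)) card_scale_orbits prednK //.
rewrite -mulnA (card_Hall hallK) partnC // divnK //.
rewrite /m card_finField_unit -subn1 -(exp1n n) subn_exp.
by rewrite !exp1n dvdn_mulr.
Qed.
End GL.

Local Close Scope group_scope.

Theorem corollary3p5 (q n : nat) (F : finFieldType)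
    (hq : exists p k : nat, prime p /\ 0 < k /\ q = p ^ k)
    (hF : #|F| = q) (hn : 2 <= n) :
  min_perm_degree 'GL_n[F]%G
    <= (q ^ n - 1) %/ (q - 1) * gcd_part n q (q - 1) + T_sum n q (q - 1).
Proof.
pose pi : nat_pred := [pred p | p %| gcdn n (q - 1)].
have := @GL_degree_le F n pi (ltnW hn).
rewrite hF /gcd_part /T_sum (partn_primes pi); apply.
(* A prime divisor of [q - 1] lies outside [pi] exactly when it does not divide [n]. *)
move=> p; rewrite mem_primes inE /= dvdn_gcd => /and3P[_ _ ->].
by rewrite andbT.
Qed.
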